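(* Let $0<q<1$, and for integers $n,s\ge 0$ define \[ f(n,s):=\frac{1}{c(q)}\int_{-\nu}^{\nu}x^{2n}H_s(x,q)^2\,w_G(x)\,d_qx . \] Then for all integers $n\ge0$ and $s\ge2$, \[ f(n,s)=f(n+1,s-1)-2\sum_{l=0}^{s-2}(-1)^{s-l}\,\frac{q^{\binom{s-1}{2}}[s-1]_q!}{q^{\binom{l}{2}}[l]_q!}\,f(n+1,l)+q^{2(s-2)}[s-1]_q^2\,f(n,s-2), \] with $f(n,0)=[2n-1]_q!!$ and $f(n,1)=[2n+1]_q!!$ for all $n\ge0$.
   Context: For an integer $m\ge0$, $[m]_q=\frac{1-q^m}{1-q}$, $[m]_q!=\prod_{i=1}^m[i]_q$, and $[2m-1]_q!!=[2m-1]_q[2m-3]_q\cdots[3]_q[1]_q$ (equal to $1$ for $m=0$). The $q$-Hermite polynomials $H_n(x,q)$ are defined by $H_0=1$, $H_1=x$, and $H_{n+1}(x,q)=xH_n(x,q)-q^{n-1}[n]_qH_{n-1}(x,q)$ for $n\ge1$. The Gaussian $q$-distribution is $w_G(x)=E_{q^2}^{-q^2x^2/[2]_q}$, where $E_q^x=\sum_{m=0}^\infty q^{\binom m2}\frac{x^m}{[m]_q!}$ (and $E_{q^2}$ is obtained by replacing $q$ by $q^2$); explicitly, $w_G(x)=\sum_{m=0}^{\infty}\frac{q^{m(m+1)}(q-1)^m}{\prod_{i=0}^{m-1}(1-q^{2i+2})}x^{2m}$. The Jackson $q$-integral is $\int_0^b f(x)\,d_qx=(1-q)\,b\sum_{m=0}^\infty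 q^m f(q^m b)$ and $\int_a^b f\,d_qx=\int_0^b f\,d_qx-\int_0^a f\,d_qx$. Moreover $\nu=\frac{1}{\sqrt{1-q}}$ and \[ c(q)=\int_{-\nu}^{\nu}w_G(x)\,d_qx=2\sqrt{1-q}\,\sum_{m=0}^{\infty}\frac{(-1)^m q^{m(m+1)}}{(1-q^{2m+1})\prod_{i=0}^{m-1}(1-q^{2i+2})}. \] *)

(* Defs.v *)
From HB Require Import structures.
From mathcomp Require Import all_boot all_order all_algebra.
From mathcomp Require Import reals topology normedtype sequences.

Set Implicit Arguments.
Unset Strict Implicit.
Unset Printing Implicit Defensive.

Import Order.TTheory GRing.Theory Num.Theory.
Import numFieldNormedType.Exports.

Local Open Scope ring_scope.

(* limn is total (it has an arbitrary value on divergent sequences), but for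
   0 < q < 1 the series defining the Gaussian weight and its moments converge. *)

Section QCalculus.
Variable R : realType.
Implicit Types (q x a b : R) (m n s : nat) (f : R -> R).

Definition qnum q m : R := (1 - q ^+ m) / (1 - q).

Definition qfact q m : R := \prod_(1 <= i < m.+1) qnum q i.

(* [2m-1]_q!!, indexed by m *)
Definition qodd_dfact q m : R := \prod_(0 <= i < m) qnum q (2 * i + 1).

Fixpoint qHermite q n : {poly R} :=
  match n with
  | 0 => 1
  | n1.+1 =>
    match n1 with
    | 0 => 'X
    | n2.+1 =>
      'X * qHermite q n1 - (q ^+ n2 * qnum q n1) *: qHermite q n2
    end
  end.

(* E_q^x *)
Definition qExp q x : R :=
  limn (series (fun m => q ^+ 'C(m, 2) * (x ^+ m / qfact q m))).

Definition wG q x : R :=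
  qExp (q ^+ 2) (- (q ^+ 2 * x ^+ 2) / qnum q 2).

Definition jackson0 q b f : R :=
  (1 - q) * b * limn (series (fun m => q ^+ m * f (q ^+ m * b))).

Definition jackson q a b f : R := jackson0 q b f - jackson0 q a f.

Definition nu q : R := 1 / Num.sqrt (1 - q).

Definition cG q : R := jackson q (- nu q) (nu q) (wG q).

Definition fHermite q n s : R :=
  1 / cG q *
  jackson q (- nu q) (nu q)
    (fun x => x ^+ (2 * n) * (qHermite q s).[x] ^+ 2 * wG q x).

End QCalculus.

(* Main.v *)
(* The recurrence is linear: squaring H_s = x H_(s-1) - q^(s-2) [s-1]_q H_(s-2)
   and unrolling x H_(k+1) H_k = x^2 H_k^2 - q^(k-1) [k]_q x H_k H_(k-1) gives an
   identity of polynomials, to which the functional "integrate against w_G" is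
   applied. For the initial values, E_q^x = (1 + (1-q) x) E_q^(qx) turns into
   w(q^m nu) = (1 - q^(2m+2)) w(q^(m+1) nu) on the Jackson nodes, whence
   positivity and boundedness of the weight (it tends to 1 along the nodes), and,
   by summation by parts, the moment relation m_(k+2) = [k+1]_q m_k. *)
Require Import Defs.
From HB Require Import structures.
From mathcomp Require Import all_boot all_order all_algebra.
From mathcomp Require Import ring lra zify.
From mathcomp Require Import boolp classical_sets.
From mathcomp Require Import reals topology normedtype sequences.

Set Implicit Arguments.
Unset Strict Implicit.
Unset Printing Implicit Defensive.

Import Order.TTheory GRing.Theory Num.Theory.
Import numFieldNormedType.Exports.

Local Open Scope ring_scope.

(** * Index shifts and convergence tests for real series *)

Section Series.
Variable R : realType.
Implicit Types u : R ^nat.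

Lemma series_recl u n :
  series u n.+1 = u 0%N + series (fun m => u m.+1) n.
Proof. by rewrite /series /= big_nat_recl. Qed.

Lemma is_cvg_series_shiftS u :
  cvgn (series (fun m => u m.+1)) <-> cvgn (series u).
Proof.
have uS : series (fun m => u m.+1) = (fun n => series u n.+1 - u 0%N).
  by apply/funext => n; rewrite series_recl addrC addKr.
split=> cu; last first.
  rewrite uS; apply: is_cvgB; last exact: is_cvg_cst.
  by apply/cvg_ex; exists (limn (series u)); rewrite (cvg_shiftS (series u)).
apply/cvg_ex; exists (u 0%N + limn (series (fun m => u m.+1))).
rewrite -cvg_shiftS; under eq_fun do rewrite /= series_recl.
by apply: cvgD => //; apply: cvg_cst.
Qed.

Lemma lim_series_recl u : cvgn (series u) ->
  limn (series u) = u 0%N + limn (series (fun m => u m.+1)).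
Proof.
move=> /(iffRL (is_cvg_series_shiftS _)) cu; apply/cvg_lim => //.
rewrite -cvg_shiftS; under eq_fun do rewrite /= series_recl.
by apply: cvgD => //; apply: cvg_cst.
Qed.

Lemma is_cvg_series_geometric_bound u C r : 0 <= r -> r < 1 ->
  (forall m, `|u m| <= C * r ^+ m) -> cvgn (series u).
Proof.
move=> r0 r1 uC; apply: normed_cvg.
apply: (@series_le_cvg _ _ (geometric C r)) => [n|n|n|] /=; last 1 first.
- by apply: is_cvg_geometric_series; rewrite ger0_norm.
- exact: normr_ge0.
- exact: le_trans (normr_ge0 _) (uC n).
- exact: uC.
Qed.

(** Induction on [N] drops leading terms, which does not affect convergence; once [N = 0], iterating
    the ratio bound gives domination by [|u 0| r^m]. *)
Lemma is_cvg_series_ratio u r N : 0 <= r -> r < 1 ->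
  (forall m, (N <= m)%N -> `|u m.+1| <= r * `|u m|) -> cvgn (series u).
Proof.
move=> r0 r1; elim: N u => [|N IH] u ur; last first.
  by apply/is_cvg_series_shiftS; apply: IH => m Nm; apply: ur.
apply: (@is_cvg_series_geometric_bound _ `|u 0%N| r) => //.
elim=> [|m IHm]; first by rewrite expr0 mulr1.
by apply: le_trans (ur _ isT) _; rewrite exprS mulrCA ler_wpM2l.
Qed.

End Series.

(** * The q-exponential series *)

Section QExp.
Local Open Scope classical_set_scope.
Local Open Scope ring_scope.
Variables (R : realType) (q : R).
Hypotheses (q_gt0 : 0 < q) (q_lt1 : q < 1).

Let subq_neq0 : 1 - q != 0.
Proof. by rewrite subr_eq0 gt_eqF. Qed.

Lemma qnum_ge1 m : 1 <= qnum q m.+1.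
Proof.
rewrite /qnum ler_pdivlMr ?subr_gt0// mul1r lerB// exprS ler_piMr ?(ltW q_gt0)//.
by rewrite exprn_ile1// ltW.
Qed.

Lemma qnum_neq0 m : qnum q m.+1 != 0.
Proof. by rewrite gt_eqF// (lt_le_trans ltr01)// qnum_ge1. Qed.

Lemma qfact0 : qfact q 0 = 1.
Proof. by rewrite /qfact big_geq. Qed.

Lemma qfactS m : qfact q m.+1 = qfact q m * qnum q m.+1.
Proof. by rewrite /qfact big_nat_recr. Qed.

Lemma qfact_neq0 m : qfact q m != 0.
Proof.
by elim: m => [|m IH]; rewrite ?qfact0 ?oner_eq0// qfactS mulf_neq0// qnum_neq0.
Qed.

Let qExp_term (x : R) m : R := q ^+ 'C(m, 2) * (x ^+ m / qfact q m).

Let qExp_term0 x : qExp_term x 0 = 1.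
Proof. by rewrite /qExp_term qfact0 !expr0 divr1 mulr1. Qed.

Let qExp_termS x m :
  qExp_term x m.+1 = q ^+ m * x / qnum q m.+1 * qExp_term x m.
Proof.
rewrite /qExp_term binS bin1 qfactS exprD exprS.
by field; rewrite qfact_neq0 qnum_neq0.
Qed.

Let qExp_termMq x m : qExp_term (q * x) m = q ^+ m * qExp_term x m.
Proof. by rewrite /qExp_term exprMn; ring. Qed.

Let norm_qExp_termS x m :
  `|qExp_term x m.+1| <= q ^+ m * `|x| * `|qExp_term x m|.
Proof.
rewrite qExp_termS normrM ler_wpM2r// !normrM (ger0_norm (exprn_ge0 _ (ltW q_gt0))).
rewrite ler_piMr ?mulr_ge0 ?exprn_ge0 ?(ltW q_gt0)//.
by rewrite ger0_norm ?invr_ge0 ?invf_le1 ?qnum_ge1//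
  ?(lt_le_trans ltr01) ?(le_trans ler01) ?qnum_ge1.
Qed.

Lemma is_cvg_qExp x :
  cvgn (series (fun m => q ^+ 'C(m, 2) * (x ^+ m / qfact q m))).
Proof.
(* Consecutive terms have ratio at most [q^m |x|], which tends to 0, so the ratio test applies for
   every [x]. *)
have [N _ qN] : \forall N \near \oo, q ^+ N * `|x| < 2^-1.
  have : (fun N => q ^+ N * `|x|) @ \oo --> (0 * `|x| : R).
    by apply: cvgMl; apply: cvg_expr; rewrite ger0_norm// ltW.
  by rewrite mul0r => /cvgr_lt; apply; rewrite invr_gt0.
apply: (@is_cvg_series_ratio _ _ 2^-1 N); [lra|lra|] => m Nm.
by apply: le_trans (norm_qExp_termS x m) _; rewrite ler_wpM2r// ltW// qN.
Qed.

(** Termwise: with [t_m(x)] the m-th term, [t_m(qx) = q^m t_m(x)], hence [t_(m+1)(x) - t_(m+1)(qx) =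
    (1 - q^(m+1)) t_(m+1)(x) = (1 - q) x t_m(qx)]. *)
Lemma qExp_rec x : qExp q x = (1 + (1 - q) * x) * qExp q (q * x).
Proof.
have cx := @is_cvg_qExp x; have cqx := @is_cvg_qExp (q * x).
suff : qExp q x - qExp q (q * x) = ((1 - q) * x) *: qExp q (q * x).
  by move=> /(canRL (subrK _)) ->; rewrite [RHS]mulrDl mul1r [LHS]addrC.
rewrite {1 2}/qExp (lim_series_recl cx) (lim_series_recl cqx) !expr0.
rewrite opprD addrACA subrr add0r.
have cxS := iffRL (is_cvg_series_shiftS _) cx.
have cqxS := iffRL (is_cvg_series_shiftS _) cqx.
rewrite -lim_seriesB// -lim_seriesZ//; congr (limn (series _)).
apply/funext => m; rewrite -[LHS]/(qExp_term x m.+1 - qExp_term (q * x) m.+1).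
rewrite -[RHS]/((1 - q) * x * qExp_term (q * x) m) !qExp_termMq qExp_termS.
(* [field] divides by the numerator [1 - q^(m+1)] of the q-number, so its nonvanishing is extracted
   here. *)
move: (qnum_neq0 m); rewrite /qnum mulf_eq0 invr_eq0 (negPf subq_neq0) orbF => qm.
by rewrite exprS; field; rewrite -exprS qm subq_neq0.
Qed.

(** The terms after the leading 1 are dominated by [3^-(m+1)], whose sum is 1/2. This keeps the
    weight away from 0 at nodes near the origin. *)
Lemma qExp_near1 x : `|x| <= 3^-1 -> `|qExp q x - 1| <= 2^-1.
Proof.
move=> x3; have cx := @is_cvg_qExp x.
have bnd m : `|qExp_term x m.+1| <= 3^-1 * 3^-1 ^+ m.
  elim: m => [|m IH].
    by apply: le_trans (norm_qExp_termS x 0) _; rewrite qExp_term0 normr1; lra.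
  apply: le_trans (norm_qExp_termS x _) _; rewrite [in leRHS]exprS.
  apply: ler_pM => //; first by rewrite mulr_ge0 ?exprn_ge0// ltW.
  by apply: le_trans x3; rewrite ler_piMl// exprn_ile1// ltW.
have g3 : `|3^-1 : R| < 1 by rewrite ger0_norm; lra.
have cg := @is_cvg_geometric_series R 3^-1 _ g3.
have cn : cvgn [normed series (fun m => qExp_term x m.+1)].
  apply: series_le_cvg cg => [n|n|n] /=; last exact: bnd; first exact: normr_ge0.
  by rewrite mulr_ge0 ?exprn_ge0 ?invr_ge0.
rewrite /qExp (lim_series_recl cx) -/(qExp_term x 0) qExp_term0 addrC addKr.
apply: le_trans (lim_series_norm cn) _; apply: le_trans (lim_series_le cn cg _) _ => //.
by rewrite (cvg_lim _ (@cvg_geometric_series R 3^-1 _ g3))// ler_pdivrMr; lra.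
Qed.

End QExp.

(** * The Gaussian weight on the Jackson nodes, and its moments *)

Section Gaussian.
Variables (R : realType) (q : R).
Hypotheses (q_gt0 : 0 < q) (q_lt1 : q < 1).
Local Open Scope classical_set_scope.
Local Open Scope ring_scope.

Let subq_gt0 : 0 < 1 - q.
Proof. by rewrite subr_gt0. Qed.

Let q_ge0 : 0 <= q.
Proof. exact: ltW. Qed.

(** The functional equation of the q-exponential in base [q^2], with [(1 - q^2) / [2]_q = 1 - q]. *)
Lemma wG_rec x : wG q x = (1 - (1 - q) * q ^+ 2 * x ^+ 2) * wG q (q * x).
Proof.
rewrite /wG qExp_rec ?exprn_gt0 ?exprn_ilt1//; congr (_ * qExp _ _); rewrite /qnum.
  by field; rewrite !gt_eqF// subr_gt0 exprn_ilt1.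
by rewrite exprMn; ring.
Qed.

Lemma wGN x : wG q (- x) = wG q x.
Proof. by rewrite /wG sqrrN. Qed.

(* Instantiated with both b = nu q and b = - nu q. *)
Variable b : R.
Hypothesis b2 : b ^+ 2 = (1 - q)^-1.

Lemma wG_node_rec m :
  wG q (q ^+ m * b) = (1 - q ^+ (2 * m.+1)) * wG q (q ^+ m.+1 * b).
Proof.
rewrite wG_rec mulrA -exprS exprMn b2; congr (_ * _).
rewrite mulnC exprM (exprS q m); field; exact: lt0r_neq0.
Qed.

(** Nodes close to 0 have weight within 1/2 of 1. Stepping back to an earlier node multiplies the
    weight by a factor in (0, 1), which preserves both bounds. *)
Lemma wG_node_bounds m : 0 < wG q (q ^+ m * b) <= 2.
Proof.
(* The factor [1 - q] cancels the [(1 - q)^-1] coming from [b^2], so that the argument of the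
   q-exponential is at most 1/3. *)
have [N _ qN] : \forall N \near \oo, q ^+ N < 3^-1 * (1 - q).
  have : (fun N => q ^+ N) @ \oo --> (0 : R).
    by apply: cvg_expr; rewrite ger0_norm.
  by move=> /cvgr_lt; apply; rewrite mulr_gt0// invr_gt0.
have large k : (N <= k)%N -> 0 < wG q (q ^+ k * b) <= 2.
  move=> Nk; suff : `|wG q (q ^+ k * b) - 1| <= 2^-1.
    by rewrite ler_distl => /andP[? ?]; apply/andP; split; lra.
  rewrite /wG; apply: qExp_near1; rewrite ?exprn_gt0 ?exprn_ilt1//.
  have n2 := @qnum_ge1 _ _ q_gt0 q_lt1 1.
  have n2' : 0 < qnum q 2 by lra.
  rewrite normrM normrN normfV (gtr0_norm n2') ler_pdivrMr// exprMn b2.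
  rewrite !normrM normfV !normrX !(gtr0_norm q_gt0) (gtr0_norm subq_gt0).
  apply: (@le_trans _ _ (3^-1)); last by lra.
  rewrite mulrA ler_pdivrMr//; apply: le_trans (ltW (qN k Nk)).
  have t0 : 0 <= q ^+ k by rewrite exprn_ge0.
  have t1 : q ^+ k <= 1 by rewrite exprn_ile1// ltW.
  by rewrite mulrA -[leRHS]mul1r ler_wpM2r// !mulr_ile1// ?mulr_ge0// ltW.
have : 0 < wG q (q ^+ (m + N) * b) <= 2 by apply: large; rewrite leq_addl.
elim: N {qN large} => [|N IH]; first by rewrite addn0.
rewrite addnS => /andP[w0 w2]; apply: IH; rewrite wG_node_rec.
have f1 : 0 < 1 - q ^+ (2 * (m + N).+1) by rewrite subr_gt0 exprn_ilt1.
rewrite mulr_gt0//= (le_trans _ w2)// ler_piMl ?(ltW w0)//.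
by rewrite gerBl exprn_ge0.
Qed.

Let w m := wG q (q ^+ m * b).

(** All nodes lie in the disk of radius [|b|], where [p] is bounded; with the weight at most 2, the
    factor [q^m] gives a geometric majorant. *)
Lemma is_cvg_jackson_poly (p : {poly R}) :
  cvgn (series (fun m => q ^+ m * (p.[q ^+ m * b] * wG q (q ^+ m * b)))).
Proof.
have [M pM] := poly_disk_bound p `|b|.
apply: (@is_cvg_series_geometric_bound _ _ (M * 2) q) => // m.
have /andP[w0 w2] := wG_node_bounds m.
rewrite normrM mulrC (ger0_norm (exprn_ge0 _ q_ge0)) ler_wpM2r ?exprn_ge0// normrM.
rewrite ler_pM//; last by rewrite gtr0_norm.
by apply: pM; rewrite normrM ler_piMl// ger0_norm ?exprn_ge0// exprn_ile1// ltW.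
Qed.

Lemma jackson0_poly_linear (c : R) (p r : {poly R}) :
  jackson0 q b (fun x => (c *: p + r).[x] * wG q x) =
  c * jackson0 q b (fun x => p.[x] * wG q x) + jackson0 q b (fun x => r.[x] * wG q x).
Proof.
have cp := @is_cvg_jackson_poly p; have cr := @is_cvg_jackson_poly r.
rewrite /jackson0 mulrCA -mulrDr; congr (_ * _).
rewrite -[c * limn _]/(c *: limn _) -lim_seriesZ// -lim_seriesD//;
  last exact: is_cvg_seriesZ.
congr (limn (series _)); apply/funext => m.
rewrite -[RHS]/(c * (q ^+ m * (p.[q ^+ m * b] * w m)) + q ^+ m * (r.[q ^+ m * b] * w m)).
by rewrite /w hornerD hornerZ; ring.
Qed.

(* In the summation by parts, the boundary term vanishes because
   1 - q^(2m) = 0 at m = 0. *)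
Lemma jackson0_monomial k :
  jackson0 q b (fun x => x ^+ k.+2 * wG q x) =
  qnum q k.+1 * jackson0 q b (fun x => x ^+ k * wG q x).
Proof.
pose S j := limn (series (fun m => q ^+ (j.+1 * m) * w m)).
have cS j : cvgn (series (fun m => q ^+ (j.+1 * m) * w m)).
  apply: (@is_cvg_series_geometric_bound _ _ 2 q) => // m.
  have /andP[w0 w2] := wG_node_bounds m.
  rewrite normrM mulrC ler_pM//; first by rewrite gtr0_norm.
  by rewrite ger0_norm ?exprn_ge0//; apply: ler_wiXn2l; rewrite // ?ltW// leq_pmull.
have jS j : jackson0 q b (fun x => x ^+ j * wG q x) = (1 - q) * b * b ^+ j * S j.
  rewrite /jackson0 -[RHS]mulrA; congr (_ * _).
  rewrite -[b ^+ j * S j]/(b ^+ j *: S j) -lim_seriesZ//.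
  congr (limn (series _)); apply/funext => m.
  rewrite -[RHS]/(b ^+ j * (q ^+ (j.+1 * m) * w m)) mulSn exprD mulnC exprM exprMn -/(w m).
  by ring.
(* The difference has terms [q^((k+1)m) (1 - q^(2m)) w m]. After dropping [m = 0] and shifting,
   [wG_node_rec] absorbs [1 - q^(2(m+1))] and turns [w m.+1] into [w m]. *)
have SS : S k - S k.+2 = q ^+ k.+1 * S k.
  rewrite -lim_seriesB// lim_series_recl; last exact: is_cvg_seriesB.
  rewrite -[X in X + _]/(q ^+ (k.+1 * 0) * w 0 - q ^+ (k.+3 * 0) * w 0).
  rewrite !muln0 subrr add0r.
  rewrite -[q ^+ k.+1 * S k]/(q ^+ k.+1 *: S k) -lim_seriesZ//.
  congr (limn (series _)); apply/funext => m.
  rewrite -[LHS]/(q ^+ (k.+1 * m.+1) * w m.+1 - q ^+ (k.+3 * m.+1) * w m.+1).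
  rewrite -[RHS]/(q ^+ k.+1 * (q ^+ (k.+1 * m) * w m)) /w (wG_node_rec m).
  have -> : (k.+3 * m.+1 = k.+1 * m.+1 + 2 * m.+1)%N by rewrite -mulnDl addn2.
  by rewrite exprD mulnS exprD; ring.
rewrite !jS (_ : S k.+2 = S k - (S k - S k.+2)); last by ring.
rewrite SS /qnum -(add2n k) exprD b2.
by field; rewrite lt0r_neq0.
Qed.

(** The factor [b], whose sign is not fixed by [b^2], is kept apart from the sum [S], which is at
    least its positive first term. *)
Lemma jackson0_wG : exists2 S, 0 < S & jackson0 q b (wG q) = (1 - q) * b * S.
Proof.
exists (limn (series (fun m => q ^+ m * wG q (q ^+ m * b)))) => //.
have cw : cvgn (series (fun m => q ^+ m * wG q (q ^+ m * b))).
  rewrite (_ : (fun m => _) = fun m => q ^+ m * (1.[q ^+ m * b] * w m)).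
    exact: is_cvg_jackson_poly.
  by apply/funext => m; rewrite hornerC mul1r.
have pos m : 0 < q ^+ m * wG q (q ^+ m * b).
  by have /andP[w0 _] := wG_node_bounds m; rewrite mulr_gt0// exprn_gt0.
rewrite lim_series_recl// (lt_le_trans (pos 0%N))// lerDl.
apply: limr_ge; first exact: (iffRL (is_cvg_series_shiftS _) cw).
by apply: nearW => n; rewrite /series /= sumr_ge0// => i _; rewrite ltW.
Qed.

End Gaussian.

(** * q-Hermite polynomials and the recurrence for their moments *)

Section Hermite.
Variables (R : realType) (q : R).
Hypotheses (q_gt0 : 0 < q) (q_lt1 : q < 1).

Let nu2 : nu q ^+ 2 = (1 - q)^-1.
Proof. by rewrite /nu div1r exprVn sqr_sqrtr// subr_ge0 ltW. Qed.

Let nuN2 : (- nu q) ^+ 2 = (1 - q)^-1.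
Proof. by rewrite sqrrN. Qed.

(** Restricting the integral to polynomials times the weight makes every Jackson series converge, so
    that it is a linear functional. *)
Let L (p : {poly R}) : R := jackson q (- nu q) (nu q) (fun x => p.[x] * wG q x).

Let L_linear (c : R) p r : L (c *: p + r) = c * L p + L r.
Proof. by rewrite /L /jackson !jackson0_poly_linear//; ring. Qed.

Let L0 : L 0 = 0.
Proof.
have := L_linear (-1) 0 0.
by rewrite scaler0 addr0 mulN1r addNr.
Qed.

Let LD p r : L (p + r) = L p + L r.
Proof. by rewrite -[p in LHS]scale1r L_linear mul1r. Qed.

Let LZ c p : L (c *: p) = c * L p.
Proof. by rewrite -[c *: p]addr0 L_linear L0 addr0. Qed.

(** The weight is even, so the Jackson integral from 0 to [- nu q] is the opposite of the one to
    [nu q], and [cG q] is twice a positive number. *)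
Lemma cG_gt0 : 0 < cG q.
Proof.
have [S S0 jS] := jackson0_wG q_gt0 q_lt1 nu2.
have jN : jackson0 q (- nu q) (wG q) = - jackson0 q (nu q) (wG q).
  rewrite /jackson0 mulrN mulNr; congr (- (_ * _)).
  congr (limn (series _)); by apply/funext => m; rewrite mulrN wGN.
rewrite /cG /jackson jN opprK jS.
have nu0 : 0 < nu q by rewrite /nu div1r invr_gt0 sqrtr_gt0 subr_gt0.
by apply: addr_gt0; do 2?apply: mulr_gt0; rewrite ?subr_gt0.
Qed.

Lemma fHermiteE n s :
  fHermite q n s = 1 / cG q * L ('X^(2 * n) * qHermite q s ^+ 2).
Proof.
rewrite /fHermite /L; congr (_ * jackson _ _ _ _); apply/funext => x.
by rewrite hornerM hornerXn horner_exp.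
Qed.

(** The product of the coefficients [q^(k-1) [k]_q] of the Hermite recurrence over [1 <= k <= m]. *)
Definition qHcoef m : R := q ^+ 'C(m, 2) * qfact q m.

Lemma qHcoef_neq0 m : qHcoef m != 0.
Proof. by rewrite mulf_neq0 ?qfact_neq0// expf_neq0// gt_eqF. Qed.

Lemma qHcoefS m : qHcoef m.+1 = q ^+ m * qnum q m.+1 * qHcoef m.
Proof. by rewrite /qHcoef binS bin1 exprD qfactS; ring. Qed.

Lemma qHermiteSS s : qHermite q s.+2 =
  'X * qHermite q s.+1 - (q ^+ s * qnum q s.+1) *: qHermite q s.
Proof. by []. Qed.

(** Each unrolling of the three-term recurrence contributes a sign and one coefficient, hence the
    ratios of [qHcoef]. It ends without remainder because [H_1 = x] and [H_0 = 1]. *)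
Lemma qHermite_mulX s : 'X * qHermite q s.+1 * qHermite q s =
  \sum_(0 <= l < s.+1) ((-1) ^+ (s + l) * (qHcoef s / qHcoef l)) *:
    ('X^2 * qHermite q l ^+ 2).
Proof.
elim: s => [|s IH].
  by rewrite big_nat1 /= divff ?qHcoef_neq0// addn0 expr0 !mulr1 scale1r expr1n mulr1 expr2.
rewrite qHermiteSS mulrBr mulrBl big_nat_recr// addrC; congr (_ + _).
  rewrite -scalerAr -scalerAl mulrAC IH -scaleNr scaler_sumr.
  apply: eq_bigr => l _; rewrite scalerA qHcoefS; congr (_ *: _).
  by rewrite addSn exprS; ring.
rewrite addnn -signr_odd odd_double divff ?qHcoef_neq0// mulr1 scale1r.
by rewrite -/(qHermite q s.+1); ring.
Qed.

Lemma qHermite_sqr s : qHermite q s.+2 ^+ 2 =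
  'X^2 * qHermite q s.+1 ^+ 2
  - 2 *: (\sum_(0 <= l < s.+1) ((-1) ^+ (s.+2 - l) * (qHcoef s.+1 / qHcoef l)) *:
    ('X^2 * qHermite q l ^+ 2))
  + (q ^+ (2 * s) * qnum q s.+1 ^+ 2) *: qHermite q s ^+ 2.
Proof.
set a := q ^+ s * qnum q s.+1.
have -> : \sum_(0 <= l < s.+1) ((-1) ^+ (s.+2 - l) * (qHcoef s.+1 / qHcoef l)) *:
    ('X^2 * qHermite q l ^+ 2) = a *: ('X * qHermite q s.+1 * qHermite q s).
  rewrite qHermite_mulX scaler_sumr; apply: eq_big_nat => l /andP[_ ls].
  rewrite scalerA qHcoefS -/a; congr (_ *: _).
  (* The two exponents have the same parity; the subtraction is not truncated since [l <= s]. *)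
  suff -> : (-1) ^+ (s.+2 - l) = (-1) ^+ (s + l) :> R by ring.
  by rewrite -[LHS]signr_odd -[RHS]signr_odd oddB ?oddD//=; [rewrite negbK|lia].
have -> : q ^+ (2 * s) * qnum q s.+1 ^+ 2 = a ^+ 2 by rewrite mulnC exprM -exprMn.
rewrite qHermiteSS -/a -/(qHermite q s.+1).
rewrite scaler_nat -!mul_polyC polyC_exp; ring.
Qed.

Lemma fHermite_rec n s : fHermite q n s.+2 =
  fHermite q n.+1 s.+1
  - 2 * (\sum_(0 <= l < s.+1) (-1) ^+ (s.+2 - l) * (qHcoef s.+1 / qHcoef l) *
      fHermite q n.+1 l)
  + q ^+ (2 * s) * qnum q s.+1 ^+ 2 * fHermite q n s.
Proof.
pose P m l : {poly R} := 'X^(2 * m) * qHermite q l ^+ 2.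
have fE m l : fHermite q m l = 1 / cG q * L (P m l) by exact: fHermiteE.
have XE l : 'X^(2 * n) * ('X^2 * qHermite q l ^+ 2) = P n.+1 l.
  by rewrite /P mulrA -exprD mulnS addnC.
(* Multiplying the squared recurrence by [x^(2n)] lets each factor [x^2] raise [n] by one. *)
have PE : P n s.+2 = P n.+1 s.+1
    + (- 2) *: (\sum_(0 <= l < s.+1)
        ((-1) ^+ (s.+2 - l) * (qHcoef s.+1 / qHcoef l)) *: P n.+1 l)
    + (q ^+ (2 * s) * qnum q s.+1 ^+ 2) *: P n s.
  rewrite {1}/P qHermite_sqr mulrDr mulrBr XE -!scalerAr mulr_sumr scaleNr.
  by congr (_ - _ *: _ + _); apply: eq_bigr => l _; rewrite -scalerAr XE.
have -> : \sum_(0 <= l < s.+1) (-1) ^+ (s.+2 - l) * (qHcoef s.+1 / qHcoef l) *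
      fHermite q n.+1 l = 1 / cG q * L (\sum_(0 <= l < s.+1)
        ((-1) ^+ (s.+2 - l) * (qHcoef s.+1 / qHcoef l)) *: P n.+1 l).
  rewrite (big_morph L LD L0) mulr_sumr; apply: eq_bigr => l _.
  by rewrite fE LZ mulrCA.
by rewrite !fE PE LD LD LZ LZ; ring.
Qed.

(** These are the even moments: the normalization gives the value 1 at [n = 0], and the moment
    relation at [k = 2n] adds the factor [[2n+1]_q]. *)
Lemma fHermite0 n : fHermite q n 0 = qodd_dfact q n.
Proof.
have f0E k : fHermite q k 0 =
    1 / cG q * jackson q (- nu q) (nu q) (fun x => x ^+ (2 * k) * wG q x).
  rewrite /fHermite; congr (_ * jackson _ _ _ _).
  by apply/funext => x; rewrite hornerC expr1n mulr1.
elim: n => [|n IH].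
  rewrite f0E /qodd_dfact big_geq// (_ : (fun x => _) = wG q); last first.
    by apply/funext => x; rewrite expr0 mul1r.
  by rewrite -/(cG q) div1r mulVf// gt_eqF// cG_gt0.
rewrite /qodd_dfact big_nat_recr//= -/(qodd_dfact q n) -IH !f0E.
have -> : (2 * n.+1 = (2 * n).+2)%N by rewrite mulnS.
by rewrite /jackson !jackson0_monomial// addn1; ring.
Qed.

Lemma fHermite1 n : fHermite q n 1 = fHermite q n.+1 0.
Proof.
rewrite !fHermiteE /= expr1n mulr1 -exprD; congr (_ * L 'X^_).
by rewrite mulnS addnC.
Qed.

End Hermite.

Theorem lemma5p17 (R : realType) (q : R) (hq0 : 0 < q) (hq1 : q < 1) :
  (forall n s : nat, (2 <= s)%N ->
     fHermite q n s =
       fHermite q n.+1 (s - 1)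
       - 2 * (\sum_(0 <= l < (s - 2).+1)
                (-1) ^+ (s - l)
                * (q ^+ 'C(s - 1, 2) * qfact q (s - 1)
                   / (q ^+ 'C(l, 2) * qfact q l))
                * fHermite q n.+1 l)
       + q ^+ (2 * (s - 2)) * qnum q (s - 1) ^+ 2 * fHermite q n (s - 2))
  /\ (forall n : nat, fHermite q n 0 = qodd_dfact q n)
  /\ (forall n : nat, fHermite q n 1 = qodd_dfact q n.+1).
Proof.
split; [|split] => [n [|[|s]]// _ | n | n]; last 2 first.
- exact: fHermite0.
- by rewrite fHermite1 fHermite0.
(* With the index written as [s.+2], the natural-number subtractions of the statement compute
   exactly. *)
by rewrite fHermite_rec// !subSS !subn0.
Qed.
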